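(* Let $q_\varepsilon(t)$ be a space change of $q(t)$, $\theta_\varepsilon(t)$ a time change, and $G(\varepsilon,t)$ a BH-function, and suppose $L(t,q(t),\dot q(t))\neq0$ for all $t\in I$. Define the additional BH-function $\mathcal{G}$ and the function $\mathcal{T}$ by $$\mathcal{G}(\varepsilon,t):=\varepsilon\cdot L\bigl(t,q(t),\dot q(t)\bigr)\bigl(\partial_\epsilon\theta_\epsilon(t)|_{\epsilon=0}\bigr),\qquad \mathcal{T}(\varepsilon,t):=\varepsilon\cdot\frac{\partial_\epsilon G(\epsilon,t)|_{\epsilon=0}}{L\bigl(t,q(t),\dot q(t)\bigr)} .$$ Then the following three conditions are equivalent: (1) the infinitesimal alternative BH-invariance under space and time change holds with $G$ replaced by the constant $0$, the time change $\theta_\varepsilon(t)$ replaced by $\theta_\varepsilon(t)+\mathcal{T}(\varepsilon,t)$, and $q_\varepsilon(t)$ replaced by either of the following (the equivalence holding for either choice) $$\mathcal{Q}_\varepsilon(t):=q_\varepsilon\Bigl(t+\varepsilon\cdot\bigl(\partial_\epsilon\mathcal{T}(\epsilon,t)|_{\epsilon=0}\bigr)\Bigr),\qquad \mathcal{Q}_\varepsilon(t):=q_\varepsilon(t)+\varepsilon\cdot\bigl(\partial_\epsilon\mathcal{T}(\epsilon,t)|_{\epsilon=0}\bigr)\dot q(t);$$ (2) the infinitesimal BH-invariance under space change holds with $G$ replaced by $G+\mathcal{G}$ and $q_\varepsilon(t)$ replaced by either of the following (the equivalence holding for either choice) $$\mathcal{Q}_\varepsilon(t):=q_\varepsilon\Bigl(t-\varepsilon\cdot\bigl(\partial_\epsilon\theta_\epsilon(t)|_{\epsilon=0}\bigr)\Bigr),\qquad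 \mathcal{Q}_\varepsilon(t):=q_\varepsilon(t)-\varepsilon\cdot\bigl(\partial_\epsilon\theta_\epsilon(t)|_{\epsilon=0}\bigr)\dot q(t);$$ (3) the infinitesimal alternative BH-invariance under space and time change holds for the given space change $q_\varepsilon$, time change $\theta_\varepsilon$ and BH-function $G$.
   Context: Let $n\ge1$ and let $L=L(t,q,\dot q)$ (the Lagrangian) be a smooth real-valued function on an open subset of $\mathbb{R}\times\mathbb{R}^n\times\mathbb{R}^n$. A dot over a function denotes the derivative in $t$. Let $t\mapsto q(t)\in\mathbb{R}^n$ be a smooth trajectory (not necessarily a solution to the Lagrange equation) on an open interval $I$ such that $(t,q(t),\dot q(t))$ lies in the domain of $L$ for all $t\in I$. All functions of $(\varepsilon,t)$ below are defined on an open neighbourhood of $\{0\}\times I$ in $\mathbb{R}\times I$ (i.e. for $t\in I$ and $\varepsilon$ close to $0$). A space change of $q$ is a smooth one-parameter family $(\varepsilon,t)\mapsto q_\varepsilon(t)\in\mathbb{R}^n$ with $q_0(t)=q(t)$ for all $t\in I$; $\dot q_\varepsilon(t)$ denotes $\partial_tq_\varepsilon(t)$. A time change is a smooth real function $(\varepsilon,t)\mapsto\theta_\varepsilon(t)$ with $\theta_0(t)=t$ for all $t\in I$; $\theta_\varepsilon'(t)$ denotes its derivative in $t$, and $\theta_\varepsilon^{-1}$ its inverse with respect to $t$. A BH-function is a smooth real function $G(\varepsilon,t)$. The action is $A_{a,b}(q)=\int_a^bL(t,q(t),\dot q(t))\,dt$. Infinitesimal BH-invariance under the space change $q_\varepsilon$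 with BH-function $G$ means $$\frac{\partial}{\partial\varepsilon}\Bigl(A_{a,b}(q_\varepsilon)+G(\varepsilon,b)-G(\varepsilon,a)\Bigr)\Big|_{\varepsilon=0}=0\quad\forall a,b\in I,$$ equivalently $\frac{\partial}{\partial\varepsilon}\bigl(L(t,q_\varepsilon(t),\dot q_\varepsilon(t))+\partial_tG(\varepsilon,t)\bigr)\big|_{\varepsilon=0}=0$ for all $t\in I$. Infinitesimal alternative BH-invariance under space and time change, for the triple $(q_\varepsilon,\theta_\varepsilon,G)$, means that, with $\tilde q_\varepsilon:=q_\varepsilon\circ\theta_\varepsilon^{-1}$, $$\frac{\partial}{\partial\varepsilon}\Bigl(A_{\theta_\varepsilon(a),\theta_\varepsilon(b)}(\tilde q_\varepsilon)+G(\varepsilon,b)-G(\varepsilon,a)\Bigr)\Big|_{\varepsilon=0}=0\quad\forall a,b\in I,$$ equivalently $$\frac{\partial}{\partial\varepsilon}\biggl(L\Bigl(\theta_\varepsilon(t),q_\varepsilon(t),\frac{\dot q_\varepsilon(t)}{\theta_\varepsilon'(t)}\Bigr)\theta_\varepsilon'(t)+\partial_tG(\varepsilon,t)\biggr)\bigg|_{\varepsilon=0}=0\quad\forall t\in I .$$ *)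

(* Defs.v *)
From HB Require Import structures.
From mathcomp Require Import all_boot all_order all_algebra.
From mathcomp Require Import all_classical all_reals all_analysis.
Set Implicit Arguments.
Unset Strict Implicit.
Unset Printing Implicit Defensive.
Import Order.TTheory GRing.Theory Num.Theory.
Import numFieldNormedType.Exports.
Local Open Scope classical_set_scope.
Local Open Scope ring_scope.

(* C^k on an open set U, by recursion on k; between finite-dimensional spaces,
   f is C^(k+1) iff it is differentiable with all its directional derivatives
   of class C^k. *)
Fixpoint Ck_on (R : realType) (V W : normedModType R) (k : nat) (U : set V)
    (f : V -> W) : Prop :=
  if k is k'.+1 then
    (forall x, U x -> differentiable f x) /\
    (forall v : V, Ck_on k' U (fun x => 'D_v f x))
  else forall x, U x -> {for x, continuous f}.

Definition smooth_on (R : realType) (V W : normedModType R) (U : set V)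
    (f : V -> W) : Prop :=
  forall k, Ck_on k U f.

(* Families (eps, t) |-> f eps t are total functions; only their values on the
   open neighbourhood U of {0} x I are meaningful. *)
Definition smooth_family (R : realType) (W : normedModType R) (I : set R)
    (f : R -> R -> W) : Prop :=
  exists U : set (R * R)%type,
    [/\ open U, (forall t, I t -> U (0, t)) &
        smooth_on U (fun p : R * R => f p.1 p.2)].

Definition space_change (R : realType) (n : nat) (I : set R)
    (q : R -> 'rV[R]_n) (qe : R -> R -> 'rV[R]_n) : Prop :=
  smooth_family I qe /\ (forall t, I t -> qe 0 t = q t).

Definition time_change (R : realType) (I : set R) (theta : R -> R -> R) : Prop :=
  smooth_family I theta /\ (forall t, I t -> theta 0 t = t).

Definition BH_function (R : realType) (I : set R) (G : R -> R -> R) : Prop :=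
  smooth_family I G.

Definition d_eps0 (R : realType) (W : normedModType R) (f : R -> R -> W)
    (t : R) : W :=
  derive1 (fun e => f e t) 0.

Definition along (R : realType) (n : nat)
    (L : R * 'rV[R]_n * 'rV[R]_n -> R) (q : R -> 'rV[R]_n) (t : R) : R :=
  L (t, q t, derive1 q t).

Definition oriented_integral (R : realType) (a b : R) (f : R -> R) : R :=
  if a <= b then \int[lebesgue_measure]_(t in `[a, b]) f t
  else - \int[lebesgue_measure]_(t in `[b, a]) f t.

Definition action (R : realType) (n : nat)
    (L : R * 'rV[R]_n * 'rV[R]_n -> R) (a b : R) (q : R -> 'rV[R]_n) : R :=
  oriented_integral a b (along L q).

(* The derivative at eps = 0 is required to exist and to vanish: derive1 alone
   takes an unspecified value at points of non-differentiability. *)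
Definition BH_invariant (R : realType) (n : nat)
    (L : R * 'rV[R]_n * 'rV[R]_n -> R) (I : set R)
    (qe : R -> R -> 'rV[R]_n) (G : R -> R -> R) : Prop :=
  forall a b, I a -> I b ->
    is_derive (0 : R) (1 : R)
      (fun e => action L a b (qe e) + G e b - G e a) 0.

(* q_eps o theta_eps^-1, where theta_eps is inverted as a function on the
   segment with endpoints a and b: for eps small, theta_eps is defined and
   injective on this segment, but in general not on all of I.  Values outside
   the image of the segment are irrelevant. *)
Definition reparam (R : realType) (n : nat) (a b : R)
    (qe : R -> R -> 'rV[R]_n) (theta : R -> R -> R) (e : R) : R -> 'rV[R]_n :=
  qe e \o 'pinv_(fun=> point) `[Num.min a b, Num.max a b] (theta e).

Definition alt_BH_invariant (R : realType) (n : nat)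
    (L : R * 'rV[R]_n * 'rV[R]_n -> R) (I : set R)
    (qe : R -> R -> 'rV[R]_n) (theta : R -> R -> R) (G : R -> R -> R) : Prop :=
  forall a b, I a -> I b ->
    is_derive (0 : R) (1 : R)
      (fun e => action L (theta e a) (theta e b) (reparam a b qe theta e)
                + G e b - G e a) 0.

Definition calG (R : realType) (n : nat)
    (L : R * 'rV[R]_n * 'rV[R]_n -> R) (q : R -> 'rV[R]_n)
    (theta : R -> R -> R) : R -> R -> R :=
  fun e t => e * (along L q t * d_eps0 theta t).

Definition calT (R : realType) (n : nat)
    (L : R * 'rV[R]_n * 'rV[R]_n -> R) (q : R -> 'rV[R]_n)
    (G : R -> R -> R) : R -> R -> R :=
  fun e t => e * (d_eps0 G t / along L q t).

(* Main.v *)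
Require Import Defs.
From HB Require Import structures.
From mathcomp Require Import all_boot all_order all_algebra.
From mathcomp Require Import all_classical all_reals all_analysis.
From mathcomp Require Import measurable_realfun.
From mathcomp Require Import ring lra.
Set Implicit Arguments.
Unset Strict Implicit.
Unset Printing Implicit Defensive.
Import Order.TTheory GRing.Theory Num.Theory.
Import numFieldNormedType.Exports.
Local Open Scope classical_set_scope.
Local Open Scope ring_scope.

(** The three conditions ask that three functions of epsilon have derivative 0
at 0, for all a and b.  They are equivalent because, for each a and b, these
three functions have one and the same derivative at 0; no pointwise equation
has to be extracted from the integrals.

Write eta, tau and g for the epsilon-derivatives at 0 of q_epsilon,
theta_epsilon and G, let v and w be the velocity and the acceleration of q, and
let Lambda(t) = L(t, q(t), v(t)).  For epsilon close to 0, the substitution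
s = theta_epsilon(t) turns the action of the reparametrized trajectory into the
integral over the fixed segment from a to b of
L(theta, q_epsilon, q_epsilon' / theta') theta' ([Rintegral_along_reparam]).
Differentiating under the integral sign ([is_derive_integral]) and applying the
chain rule to L gives the derivative of the action at 0
([is_derive_action_reparam]): it is the integral V(a, b) of

  N(eta, tau) = dL(tau, eta, eta' - tau' v) + Lambda tau',

where dL is the differential of L at (t, q, v).  With theta_epsilon = id this is
also the derivative of the action of a mere space change
([is_derive_action]).

The algebraic heart is that N(eta + s v, tau + s) - N(eta, tau) is the
derivative of s Lambda, for every function s of t: the difference is
s dL(1, v, w) + s' Lambda, and (1, v, w) is the velocity of the curve
(t, q(t), v(t)) ([action_variation_shift]).  So the shift changes V(a, b) by the
boundary term of s Lambda ([oriented_action_variation_shift]).  Now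
- in condition (3) the derivative is V(a, b) + g(b) - g(a);
- in condition (1) the shift is s = g / Lambda, whose boundary term
  g(b) - g(a) replaces the contribution of G;
- in condition (2) the shift is s = - tau: it removes the time change, at the
  cost of the boundary term of - tau Lambda, which the additional BH-function
  compensates.
Both formulas for the modified space change have the same derivatives at
epsilon = 0 ([shift_variation]).

In N the function tau' is the epsilon-derivative of the time derivative of
theta_epsilon, whereas a shift by - tau involves the time derivative of tau, and
a shift by g / Lambda that of g.  These derivatives exist and agree with the
mixed ones by Schwarz's theorem ([jet_mixed]), itself a consequence of
differentiation under the integral sign. *)

(** * Derivatives along curves *)

Lemma is_derive_chain (R : realType) (V W : normedModType R) (f : R -> V)
    (g : V -> W) (x : R) (df : V) :
  is_derive x 1 f df -> differentiable g (f x) ->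
  is_derive x 1 (g \o f) ('D_df g (f x)).
Proof.
move=> [fx <-] dg; have df' : differentiable f x by apply/derivable1_diffP.
have dgf : differentiable (g \o f) x by exact: differentiable_comp.
apply: DeriveDef; first exact: diff_derivable.
by rewrite !deriveE// diff_comp.
Qed.

Lemma is_derive_pair (R : realType) (V W : normedModType R) (f : R -> V)
    (g : R -> W) (x : R) (df : V) (dg : W) :
  is_derive x 1 f df -> is_derive x 1 g dg ->
  is_derive x 1 (fun y => (f y, g y)) (df, dg).
Proof.
move=> [fx <-] [gx <-].
have df' : differentiable f x by apply/derivable1_diffP.
have dg' : differentiable g x by apply/derivable1_diffP.
apply: DeriveDef; first exact/diff_derivable/differentiable_pair.
by rewrite !deriveE ?diff_pair//; exact: differentiable_pair.
Qed.

Lemma is_derive_scale (R : realType) (W : normedModType R) (k : R -> R)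
    (f : R -> W) (x dk : R) (df : W) :
  is_derive x 1 k dk -> is_derive x 1 f df ->
  is_derive x 1 (fun y => k y *: f y) (k x *: df + dk *: f x).
Proof.
move=> [dkx <-] [dfx <-].
suff lim :
    h^-1 *: (((fun y => k y *: f y) \o shift x) (h *: (1 : R)) - k x *: f x)
    @[h --> 0^'] --> k x *: 'D_1 f x + 'D_1 k x *: f x.
  apply: DeriveDef; last exact: cvg_lim lim.
  by apply/cvg_ex; exists (k x *: 'D_1 f x + 'D_1 k x *: f x).
rewrite [X in X @ _ --> _](_ : _ = fun h =>
    k (h *: (1 : R) + x) *: (h^-1 *: (f (h *: (1 : R) + x) - f x)) +
    (h^-1 *: (k (h *: (1 : R) + x) - k x)) *: f x); last first.
  apply/funext => h /=; rewrite scalerA mulrC -!scalerA -scalerDr; congr (_ *: _).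
  by rewrite scalerBr scalerBl addrA subrK.
apply: cvgD; last by apply: cvgZ; [exact: dkx|exact: cvg_cst].
apply: cvgZ; last exact: dfx.
suff : {for 0, continuous (fun h : R => k (h *: 1 + x))}.
  by move=> /continuous_withinNx; rewrite scale0r add0r.
exact/differentiable_continuous/derivable1_diffP/(derivable1P _ _ _).1.
Qed.

Lemma derivable_continuous (R : realType) (W : normedModType R) (f : R -> W)
    (t : R) (df : W) :
  is_derive t 1 f df -> {for t, continuous f}.
Proof. by case=> ? _; exact/differentiable_continuous/derivable1_diffP. Qed.

(** * Functions that are C^1 in the parameter *)

Section eps_C1.
Variable R : realType.
Implicit Types (V W : normedModType R) (p : R * R).

(** The regularity in (eps, t) under which a function of t, integrated over a
segment, can be differentiated with respect to eps.  The derivative is a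
parameter, so that the rules of calculus below compute it. *)
Definition eps_C1 W (f df : R * R -> W) p :=
  [/\ {for p, continuous f},
      is_derive p.1 (1 : R) (fun e => f (e, p.2)) (df p) &
      {for p, continuous df}].

Lemma eps_C1D W (f df g dg : R * R -> W) p :
  eps_C1 f df p -> eps_C1 g dg p -> eps_C1 (f \+ g) (df \+ dg) p.
Proof.
move=> [cf ? cdf] [cg ? cdg]; split; [exact: cvgD| |exact: cvgD].
exact: is_deriveD.
Qed.

Lemma eps_C1Z W (f df : R * R -> R) (g dg : R * R -> W) p :
  eps_C1 f df p -> eps_C1 g dg p ->
  eps_C1 (fun x => f x *: g x) (fun x => f x *: dg x + df x *: g x) p.
Proof.
move=> [cf hf cdf] [cg hg cdg]; split; [exact: cvgZ| |].
  apply: is_derive_eq; first exact: (is_derive_scale hf hg).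
  by case: p {cf cdf cg cdg hf hg}.
by apply: cvgD; exact: cvgZ.
Qed.

Lemma eps_C1M (f df g dg : R * R -> R) p :
  eps_C1 f df p -> eps_C1 g dg p ->
  eps_C1 (f \* g) (fun x => f x * dg x + df x * g x) p.
Proof. exact: (@eps_C1Z R). Qed.

Lemma eps_C1V (f df : R * R -> R) p : f p != 0 ->
  eps_C1 f df p -> eps_C1 (fun x => (f x)^-1) (fun x => - (f x) ^- 2 * df x) p.
Proof.
move=> f0 [cf hf cdf].
split; [exact: cvgV| |].
  by case: p f0 hf {cf cdf} => a b /= f0 hf; exact: is_deriveV.
apply: cvgM => //; apply: cvgN; apply: cvgV; first by rewrite expf_neq0.
by rewrite /= expr2; apply: cvgM.
Qed.

Lemma eps_C1_pair V W (f df : R * R -> V) (g dg : R * R -> W) p :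
  eps_C1 f df p -> eps_C1 g dg p ->
  eps_C1 (fun x => (f x, g x)) (fun x => (df x, dg x)) p.
Proof.
move=> [cf ? cdf] [cg ? cdg]; split; [exact: cvg_pair| |exact: cvg_pair].
exact: is_derive_pair.
Qed.

Lemma eps_C1_slice W (h : R -> W) p : {for p.2, continuous h} ->
  eps_C1 (fun x => h x.2) (fun=> 0) p.
Proof.
move=> ch; split; [|rewrite /=; exact: is_derive_cst|exact: cvg_cst].
by apply: (@continuous_comp _ _ _ snd h); [exact: cvg_snd|exact: ch].
Qed.

Lemma eps_C1_eps p : eps_C1 fst (fun=> 1) p.
Proof. by split; [exact: cvg_fst|exact: is_derive_id|exact: cvg_cst]. Qed.

End eps_C1.

(** * Joint continuity of directional derivatives *)

Section jacobian.
Variables (R : realType) (n : nat).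
Local Notation V := (R * 'rV[R]_n * 'rV[R]_n)%type.

(** A C^1 function is only required to have continuous derivatives in each fixed
direction.  Expanding the direction over a basis is what makes its directional
derivative continuous in the point and the direction together. *)
Lemma derive_coord (W : normedModType R) (g : V -> W) (x v : V) :
  differentiable g x ->
  'D_v g x = v.1.1 *: 'D_(1, 0, 0) g x
    + \sum_j v.1.2 0 j *: 'D_(0, delta_mx 0 j, 0) g x
    + \sum_j v.2 0 j *: 'D_(0, 0, delta_mx 0 j) g x.
Proof.
move=> dg; rewrite !deriveE//.
under eq_bigr do rewrite deriveE// -linearZ.
under [X in _ + X]eq_bigr do rewrite deriveE// -linearZ.
rewrite -linearZ -!linear_sum -!linearD; congr ('d g x _).
case: v => [[a b] c] /=.
have -> : \sum_j b 0 j *: ((0, delta_mx 0 j, 0) : V) = (0, b, 0).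
  rewrite {2}(row_sum_delta b) (big_morph (fun u => (0, u, 0) : V)
    (id1 := 0) (op1 := +%R))//.
  - by apply: eq_bigr => j _; congr (_, _, _); rewrite scaler0.
  - by move=> u u'; congr (_, _, _); rewrite addr0.
have -> : \sum_j c 0 j *: ((0, 0, delta_mx 0 j) : V) = (0, 0, c).
  rewrite {2}(row_sum_delta c) (big_morph (fun u => (0, 0, u) : V)
    (id1 := 0) (op1 := +%R))//.
  - by apply: eq_bigr => j _; congr (_, _, _); rewrite scaler0.
  - by move=> u u'; congr (_, _, _); rewrite addr0.
congr (_, _, _) => /=.
- by rewrite !addr0 [_ *: _]mulr1.
- by rewrite scaler0 add0r addr0.
- by rewrite scaler0 !add0r.
Qed.

Lemma continuous_derive (T : topologicalType) (W : normedModType R) (g : V -> W)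
    (X v : T -> V) (p : T) :
  {for p, continuous X} -> {for p, continuous v} ->
  (\forall x \near X p, differentiable g x) ->
  (forall u, {for X p, continuous (fun x => 'D_u g x)}) ->
  {for p, continuous (fun z => 'D_(v z) g (X z))}.
Proof.
move=> cX cv dg cg.
have dgX : \forall z \near p, differentiable g (X z) := cX _ dg.
have Dg u : 'D_u g (X z) @[z --> p] --> 'D_u g (X p).
  exact: (@continuous_comp _ _ _ X (fun x => 'D_u g x)).
have cc m i j (f : T -> 'M[R]_(m, n)) (l : 'M[R]_(m, n)) : f z @[z --> p] --> l ->
    f z i j @[z --> p] --> l i j.
  move=> fl; exact: (cvg_comp _ _ fl (@coord_continuous _ _ _ i j l)).
have cv1 : (v z).1 @[z --> p] --> (v p).1 by exact: (cvg_comp _ _ cv cvg_fst).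
have cv11 : (v z).1.1 @[z --> p] --> (v p).1.1.
  by exact: (cvg_comp _ _ cv1 cvg_fst).
have cv12 : (v z).1.2 @[z --> p] --> (v p).1.2.
  by exact: (cvg_comp _ _ cv1 cvg_snd).
have cv2 : (v z).2 @[z --> p] --> (v p).2 by exact: (cvg_comp _ _ cv cvg_snd).
rewrite /prop_for /continuous_at (derive_coord _ (nbhs_singleton dgX)).
apply: cvg_trans (near_eq_cvg _) _.
  by near=> z; apply: esym; apply: derive_coord; near: z.
apply: cvgD; first apply: cvgD; first exact: cvgZ.
- apply: cvg_big => [|j _]; first exact: add_continuous.
  by apply: cvgZ => //; exact: cc.
- apply: cvg_big => [|j _]; first exact: add_continuous.
  by apply: cvgZ => //; exact: cc.
Unshelve. all: end_near. Qed.
End jacobian.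

(** Smoothness is used only through this local property, for the given functions
and for their first directional derivatives. *)
Definition C1_at (R : realType) (V W : normedModType R) (g : V -> W) (x : V) :=
  (\forall y \near x, differentiable g y) /\
  forall u, {for x, continuous (fun y => 'D_u g y)}.

Lemma C1_at_Ck (R : realType) (V W : normedModType R) (U : set V) (g : V -> W)
  (k : nat) (x : V) : open U -> U x -> Ck_on k.+1 U g -> C1_at g x.
Proof.
move=> oU Ux [dg cg]; split.
  by move: (open_nbhs_nbhs (conj oU Ux)); apply: filterS => y /dg.
move=> u; have := cg u; case: k {cg} => [|k] /=; first exact.
by move=> [dDg _]; apply: differentiable_continuous; exact: dDg.
Qed.

Lemma C1_at_derive (R : realType) (V W : normedModType R) (U : set V) (g : V -> W)
  (k : nat) (x u : V) : open U -> U x -> Ck_on k.+2 U g ->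
  C1_at (fun y => 'D_u g y) x.
Proof. by move=> oU Ux [_ /(_ u)]; exact: C1_at_Ck. Qed.

Section eps_C1_comp.
Variable R : realType.

Lemma eps_C1_comp (V W : normedModType R) (g : V -> W) (X dX : R * R -> V)
    (p : R * R) :
  eps_C1 X dX p -> C1_at g (X p) ->
  {for p, continuous (fun z => 'D_(dX z) g (X z))} ->
  eps_C1 (g \o X) (fun z => 'D_(dX z) g (X z)) p.
Proof.
move=> [cX hX cdX] [dg cg] c; have dgX := nbhs_singleton dg; split => //.
  by apply: continuous_comp => //; exact: differentiable_continuous.
by case: p cX hX cdX cg c dgX {dg} => e t *; exact: is_derive_chain.
Qed.

Lemma derive_planar (W : normedModType R) (g : R * R -> W) (x v : R * R) :
  differentiable g x ->
  'D_v g x = v.1 *: 'D_(1, 0) g x + v.2 *: 'D_(0, 1) g x.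
Proof.
move=> dg; rewrite !deriveE// -!linearZ -linearD; congr ('d g x _).
by case: v => a b; congr (_, _); rewrite /= scaler0 ?addr0 ?add0r [RHS]mulr1.
Qed.

Lemma continuous_derive_planar (T : topologicalType) (W : normedModType R)
    (g : R * R -> W) (X v : T -> R * R) (p : T) :
  {for p, continuous X} -> {for p, continuous v} -> C1_at g (X p) ->
  {for p, continuous (fun z => 'D_(v z) g (X z))}.
Proof.
move=> cX cv [dg cg].
have dgX : \forall z \near p, differentiable g (X z) := cX _ dg.
have Dg u : 'D_u g (X z) @[z --> p] --> 'D_u g (X p).
  exact: (@continuous_comp _ _ _ X (fun x => 'D_u g x)).
rewrite /prop_for /continuous_at (derive_planar _ (nbhs_singleton dgX)).
apply: cvg_trans (near_eq_cvg _) _.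
  by near=> z; apply: esym; apply: derive_planar; near: z.
have cv1 : (v z).1 @[z --> p] --> (v p).1 by exact: (cvg_comp _ _ cv cvg_fst).
have cv2 : (v z).2 @[z --> p] --> (v p).2 by exact: (cvg_comp _ _ cv cvg_snd).
by apply: cvgD; exact: cvgZ.
Unshelve. all: end_near. Qed.

Lemma eps_C1_comp_planar (W : normedModType R) (g : R * R -> W)
    (X dX : R * R -> R * R) (p : R * R) :
  eps_C1 X dX p -> C1_at g (X p) ->
  eps_C1 (g \o X) (fun z => 'D_(dX z) g (X z)) p.
Proof.
move=> hX hg; apply: eps_C1_comp => //.
by have [? _ ?] := hX; exact: continuous_derive_planar.
Qed.

Lemma eps_C1_comp_lagrangian (n : nat) (L : R * 'rV[R]_n * 'rV[R]_n -> R)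
    (X dX : R * R -> R * 'rV[R]_n * 'rV[R]_n) (p : R * R) :
  eps_C1 X dX p -> C1_at L (X p) ->
  eps_C1 (L \o X) (fun z => 'D_(dX z) L (X z)) p.
Proof.
move=> hX hL; apply: eps_C1_comp => //.
by have [? _ ?] := hX; have [? ?] := hL; exact: continuous_derive.
Qed.

Lemma eps_C1_C1 (W : normedModType R) (g : R * R -> W) (p : R * R) :
  C1_at g p -> eps_C1 g (fun z => 'D_(1, 0) g z) p.
Proof.
move=> hg; apply: (@eps_C1_comp_planar _ g id (fun=> (1, 0)) p) => //.
split; [exact: cvg_id| |exact: cvg_cst].
exact: is_derive_pair.
Qed.

Lemma is_derive_slice2 (W : normedModType R) (g : R * R -> W) (p : R * R) :
  differentiable g p ->
  is_derive p.2 1 (fun t => g (p.1, t)) ('D_(0, 1) g p).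
Proof.
case: p => e t /= dg.
have h : is_derive t 1 (fun t => (e, t)) ((0, 1) : R * R).
  exact: is_derive_pair.
exact: (is_derive_chain h dg).
Qed.

End eps_C1_comp.

(** * Families and their derivatives *)

Section jet.
Variable R : realType.
Implicit Types (W : normedModType R) (p : R * R).

(** The derivatives of a family Q which enter the first variation of an action:
Qt in time, dQ in eps, and dQt in time then in eps.  The second time derivative
does not occur, so a family such as q_eps(t + eps s(t)) keeps a jet although s
is only known to be C^1. *)
Definition jet W (Q : R -> R -> W) (Qt dQ dQt : R * R -> W) (p : R * R) :=
  [/\ eps_C1 (fun z => Q z.1 z.2) dQ p, eps_C1 Qt dQt p &
      is_derive p.2 1 (Q p.1) (Qt p)].

Lemma jetD W (Q P : R -> R -> W) Qt dQ dQt Pt dP dPt p :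
  jet Q Qt dQ dQt p -> jet P Pt dP dPt p ->
  jet (fun e t => Q e t + P e t) (Qt \+ Pt) (dQ \+ dP) (dQt \+ dPt) p.
Proof.
move=> [hQ hQt Qd] [hP hPt Pd]; split; last exact: is_deriveD.
- exact: eps_C1D hQ hP.
- exact: eps_C1D.
Qed.

Lemma jet_linear W (h dh : R -> W) p :
  is_derive p.2 1 h (dh p.2) -> {for p.2, continuous dh} ->
  jet (fun e t => e *: h t) (fun z => z.1 *: dh z.2) (fun z => h z.2)
    (fun z => dh z.2) p.
Proof.
move=> hd cdh.
have ch := derivable_continuous hd.
have aux (k : R -> W) : {for p.2, continuous k} ->
    eps_C1 (fun z => z.1 *: k z.2) (fun z => k z.2) p.
  move=> ck; have := eps_C1Z (eps_C1_eps p) (eps_C1_slice ck).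
  rewrite [X in eps_C1 _ X](_ : _ = fun z : R * R => k z.2)//.
  by apply/funext => z; rewrite scaler0 add0r scale1r.
split; [exact: aux|exact: aux|].
exact: is_deriveZ.
Qed.

Lemma jet_C2 W (Q : R -> R -> W) (F := fun z : R * R => Q z.1 z.2) p :
  C1_at F p -> C1_at (fun z => 'D_(0, 1) F z) p ->
  jet Q (fun z => 'D_(0, 1) F z) (fun z => 'D_(1, 0) F z)
    (fun z => 'D_(1, 0) (fun y => 'D_(0, 1) F y) z) p.
Proof.
move=> hF hFt; split; [exact: eps_C1_C1|exact: eps_C1_C1|].
exact: (is_derive_slice2 (nbhs_singleton hF.1)).
Qed.

(** The chain rule along phi, whose eps-derivative is (1, s). *)
Lemma jet_shift W (Q : R -> R -> W) (F := fun z : R * R => Q z.1 z.2)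
    (Ft := fun z => 'D_(0, 1) F z) (s ds : R -> R)
    (phi := fun z : R * R => (z.1, z.2 + z.1 * s z.2)) p :
  is_derive p.2 1 s (ds p.2) -> {for p.2, continuous ds} ->
  C1_at F (phi p) -> C1_at Ft (phi p) ->
  jet (fun e t => Q e (t + e * s t))
    (fun z => (1 + z.1 * ds z.2) *: Ft (phi z))
    (fun z => 'D_(1, s z.2) F (phi z))
    (fun z => (1 + z.1 * ds z.2) *: 'D_(1, s z.2) Ft (phi z)
              + ds z.2 *: Ft (phi z)) p.
Proof.
move=> hs cds hF hFt.
have cs := derivable_continuous hs.
have lin (k : R -> R) : {for p.2, continuous k} ->
    eps_C1 (fun z => z.1 * k z.2) (fun z => k z.2) p.
  move=> ck; have := eps_C1M (eps_C1_eps p) (eps_C1_slice ck).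
  rewrite [X in eps_C1 _ X](_ : _ = fun z : R * R => k z.2)//.
  by apply/funext => z; rewrite mulr0 add0r mul1r.
have hphi : eps_C1 phi (fun z => (1, s z.2)) p.
  apply: eps_C1_pair; first exact: eps_C1_eps.
  have := eps_C1D (eps_C1_slice (h := id) (p := p) cvg_id) (lin _ cs).
  rewrite [X in eps_C1 _ X](_ : _ = fun z : R * R => s z.2)//.
  by apply/funext => z; rewrite /= add0r.
split; first exact: (eps_C1_comp_planar hphi hF).
- have h1 : eps_C1 (fun z => 1 + z.1 * ds z.2) (fun z : R * R => ds z.2) p.
    have := eps_C1D (eps_C1_slice (h := fun _ : R => 1 : R) (p := p)
      (cvg_cst _)) (lin _ cds).
    rewrite [X in eps_C1 _ X](_ : _ = fun z : R * R => ds z.2); first exact.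
    by apply/funext => z; rewrite /= add0r.
  exact: (eps_C1Z h1 (eps_C1_comp_planar hphi hFt)).
- case: p hs cds hF hFt cs {lin hphi} => e t hs _ [/nbhs_singleton dF _] _ _.
  have h1 : is_derive t 1 (fun t => t + e * s t) (1 + e * ds t).
    by apply: is_deriveD.
  have h2 : is_derive t 1 (fun t => (e, t + e * s t)) (0, 1 + e * ds t).
    exact: is_derive_pair.
  apply: is_derive_eq; first exact: (is_derive_chain h2 dF).
  by rewrite derive_planar//= scale0r add0r.
Qed.

End jet.

(** * Integrals over a segment depending on a parameter *)

Section integrals.
Variable R : realType.
Local Notation mu := (@lebesgue_measure R).

(** The tube lemma. *)
Lemma near_segment (P : R * R -> Prop) (a b e0 : R) :
  (forall t, t \in `[a, b] -> \forall p \near (e0, t), P p) ->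
  \forall e \near e0, forall t, t \in `[a, b] -> P (e, t).
Proof.
move=> nP.
have /compact_near_coveringP/(_ _ (nbhs e0) (fun e t => P (e, t)) _) :=
  segment_compact (a := a) (b := b).
apply => t tab; have [[U V] [/= U0 Vt] UV] := nP t tab.
by exists (V, U) => //= -[t' e] [/= Vt' Ue]; exact: (UV (e, t')).
Qed.

(** Covering the segment for the pair (M, e), with M near infinity and e near
[e0], provides a single bound M along with the neighbourhood of [e0]. *)
Lemma near_segment_bounded (f : R * R -> R) (a b e0 : R) :
  (forall t, t \in `[a, b] -> {for (e0, t), continuous f}) ->
  exists M, \forall e \near e0, forall t, t \in `[a, b] -> `|f (e, t)| <= M.
Proof.
move=> cf.
have /compact_near_coveringP/(_ _ (filter_prod (pinfty_nbhs R) (nbhs e0))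
    (fun i t => `|f (i.2, t)| <= i.1) _) := segment_compact (a := a) (b := b).
case=> [t tab|[U V] [/= Uoo V0] UV].
  have /cvgrPdist_lt/(_ 1 ltr01) := cf t tab.
  case=> [[U V] [/= U0 Vt] UV].
  exists (V, [set i | `|f (e0, t)| + 1 <= i.1 /\ U i.2]) => /=.
    split => //; exists ([set M | `|f (e0, t)| + 1 <= M], U) => //=.
    split => //; exact: nbhs_pinfty_ge.
  move=> [t' [M e]] [/= Vt' [leM Ue]]; apply: le_trans leM.
  have := UV (e, t') (conj Ue Vt'); rewrite /= distrC => /ltW h.
  rewrite -lerBlDl; apply: le_trans h.
  exact: lerB_dist.
have [M UM] : exists M, U M by exact: (@filter_ex _ (pinfty_nbhs R)).
exists M; move: V0; apply: filterS => e Ve t tab.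
exact: (UV (M, e) (conj UM Ve)).
Qed.

Lemma continuous_segment_integrable (f : R -> R) (a b : R) :
  (forall t, t \in `[a, b] -> {for t, continuous f}) ->
  mu.-integrable `[a, b] (EFin \o f).
Proof.
move=> cf; apply: continuous_compact_integrable; first exact: segment_compact.
by apply: continuous_in_subspaceT => t; rewrite inE; exact: cf.
Qed.

Lemma continuous_slice2 (W : topologicalType) (f : R * R -> W) (e t : R) :
  {for (e, t), continuous f} -> {for t, continuous (fun t => f (e, t))}.
Proof.
move=> cf; apply: (@continuous_comp _ _ _ (fun t => (e, t)) f) => //.
exact: (cvg_pair (cvg_cst _) cvg_id).
Qed.

(** The tube lemma yields one interval of values of eps on which the
eps-derivatives exist and are bounded by one constant, for all t in the
segment; this constant dominates the difference quotients. *)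
Lemma is_derive_integral (F dF : R * R -> R) (a b : R) :
  (forall t, t \in `[a, b] -> \forall p \near (0, t), eps_C1 F dF p) ->
  is_derive (0 : R) (1 : R) (fun e => \int[mu]_(t in `[a, b]) F (e, t))
    (\int[mu]_(t in `[a, b]) dF (0, t)).
Proof.
move=> FdF.
have [M bM] : exists M, \forall e \near (0 : R),
    forall t, t \in `[a, b] -> `|dF (e, t)| <= M.
  by apply: near_segment_bounded => t /FdF/nbhs_singleton[].
have nF := near_segment FdF.
have [d /= d0 dP] : \forall e \near (0 : R), forall t, t \in `[a, b] ->
    `|dF (e, t)| <= M /\ eps_C1 F dF (e, t).
  by near=> e => t tab; split; [exact: (near bM e)|exact: (near nF e)].
have dI e : `](- d), d[%classic e -> forall t, t \in `[a, b] ->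
    `|dF (e, t)| <= M /\ eps_C1 F dF (e, t).
  rewrite /= in_itv/= => de; apply: dP; rewrite /= sub0r normrN.
  by rewrite ltr_norml.
have I0 : `](- d), d[%classic (0 : R) by rewrite /= in_itv/= oppr_lt0 d0.
have intF e : `](- d), d[%classic e ->
    mu.-integrable `[a, b] (EFin \o (fun t => F (e, t))).
  move=> de; apply: continuous_segment_integrable => t tab.
  by have [_ [? _ _]] := dI e de t tab; exact: continuous_slice2.
have derF e t : `](- d), d[%classic e -> t \in `[a, b] ->
    derivable (fun e => F (e, t)) e 1.
  by move=> de tab; have [_ [_ [? _] _]] := dI e de t tab.
have d1F e t : `](- d), d[%classic e -> t \in `[a, b] ->
    partial1of2 (fun e t => F (e, t)) e t = dF (e, t).
  move=> de tab; have [_ [_ [_ <-] _]] := dI e de t tab.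
  by rewrite partial1of2E.
have G0 (t : R) : 0 <= `|M| by [].
have intG : mu.-integrable `[a, b] (EFin \o (fun=> `|M|)).
  by apply: continuous_segment_integrable => t _; exact: cvg_cst.
have mI : measurable (`[a, b]%classic : set (measurableTypeR R)).
  exact: measurable_itv.
have Gub e t : `](- d), d[%classic e -> `[a, b]%classic t ->
    `|partial1of2 (fun e t => F (e, t)) e t| <= `|M|.
  move=> de tab; rewrite d1F//; have [+ _] := dI e de t tab.
  by move=> /le_trans; apply; exact: ler_norm.
have derF' e t : `](- d), d[%classic e -> `[a, b]%classic t ->
    derivable ((fun e t => F (e, t)) ^~ t) e 1 by exact: derF.
apply: DeriveDef.
  exact: (@derivable_under_integral _ _ _ mu (fun e t => F (e, t)) _ mI _ _ _ I0
    intF derF' _ G0 intG Gub).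
rewrite -derive1E (@differentiation_under_integral _ _ _ mu
  (fun e t => F (e, t)) _ mI _ _ _ I0 intF derF' _ G0 intG Gub).
by apply: eq_Rintegral => t; rewrite inE => tab; exact: d1F.
Unshelve. all: end_near. Qed.

Lemma FTC2_segment (f df : R -> R) (a b : R) : a <= b ->
  (forall t, t \in `[a, b] -> is_derive t 1 f (df t)) ->
  (forall t, t \in `[a, b] -> {for t, continuous df}) ->
  \int[mu]_(t in `[a, b]) df t = f b - f a.
Proof.
rewrite le_eqVlt => /predU1P[<- _ _|ab hf cdf].
  by rewrite set_itv1 Rintegral_set1 subrr.
have cf t : t \in `[a, b] -> f x @[x --> t] --> f t.
  by move=> /hf[dft _]; exact/differentiable_continuous/derivable1_diffP.
rewrite /Rintegral (@continuous_FTC2 _ df f)//.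
- by apply: continuous_in_subspaceT => t; rewrite inE; exact: cdf.
- split.
  + by move=> t /subset_itv_oo_cc/hf[].
  + by apply: cvg_at_right_filter; apply: cf; rewrite bound_itvE ltW.
  + by apply: cvg_at_left_filter; apply: cf; rewrite bound_itvE ltW.
- by move=> t /subset_itv_oo_cc/hf[_ <-]; rewrite derive1E.
Qed.

End integrals.

(** * Change of variables in the action *)

Lemma continuous_pair (T U V : topologicalType) (f : T -> U) (g : T -> V) x :
  {for x, continuous f} -> {for x, continuous g} ->
  {for x, continuous (fun y => (f y, g y))}.
Proof. by move=> cf cg; exact: cvg_pair. Qed.

Section substitution.
Variable R : realType.
Local Notation mu := (@lebesgue_measure R).

(** Needed because the derivative of a reparametrized trajectory is unspecified
at the endpoints of its interval of definition. *)
Lemma eq_Rintegral_oo (f g : R -> R) (a b : R) : a < b ->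
  mu.-integrable `[a, b] (EFin \o g) -> {in `]a, b[, f =1 g} ->
  \int[mu]_(t in `[a, b]) f t = \int[mu]_(t in `[a, b]) g t.
Proof.
move=> ab ig fg.
have mgoo : measurable_fun (`]a, b[%classic : set (measurableTypeR R)) g.
  have /integrableP[/measurable_EFinP mg _] := ig.
  by apply: measurable_funS mg => //; exact: subset_itv_oo_cc.
rewrite /Rintegral; congr fine; apply: eq_integral_itv_bounded => //.
by apply: eq_measurable_fun mgoo => t; rewrite inE /= => /fg ->.
Qed.

Variable n : nat.

(** The integrand on the left is not continuous on the closed segment; on the
open one it agrees with g composed with psi, which is continuous up to the
endpoints, where g is the integrand on the right without its factor dth.  The
usual substitution applies to the latter. *)
Lemma Rintegral_along_reparam (L : R * 'rV[R]_n * 'rV[R]_n -> R)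
    (th dth : R -> R) (x dx : R -> 'rV[R]_n) (a b : R)
    (psi : R -> R := 'pinv_(fun=> point) `[a, b] th) :
  a < b ->
  (forall t, t \in `[a, b] -> [/\ is_derive t 1 th (dth t),
     {for t, continuous dth} & 0 < dth t]) ->
  (forall t, t \in `[a, b] -> is_derive t 1 x (dx t) /\
     {for t, continuous dx}) ->
  (forall t, t \in `[a, b] ->
     {for (th t, x t, (dth t)^-1 *: dx t), continuous L}) ->
  th a < th b /\
  \int[mu]_(s in `[th a, th b]) along L (x \o psi) s =
  \int[mu]_(t in `[a, b]) (L (th t, x t, (dth t)^-1 *: dx t) * dth t).
Proof.
move=> ab hth hx hL.
have cth t : t \in `[a, b] -> {for t, continuous th}.
  by move=> /hth[/derivable_continuous].
have cx t : t \in `[a, b] -> {for t, continuous x}.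
  by move=> /hx[/derivable_continuous].
have th' t : t \in `[a, b] -> th^`()%classic t = dth t.
  by move=> /hth[[_ <-] _ _]; rewrite derive1E.
have cwth : {within `[a, b], continuous th}.
  by apply: continuous_in_subspaceT => t; rewrite inE; exact: cth.
have incr : {in `[a, b] &, {homo th : y z / y < z}}.
  apply: gtr0_derive1_lt_cc => // t /subset_itv_oo_cc tab.
    by have [[]] := hth t tab.
  by rewrite th'//; have [] := hth t tab.
have aI : a \in `[a, b] by rewrite bound_itvE ltW.
have bI : b \in `[a, b] by rewrite bound_itvE ltW.
have thab : th a < th b by exact: incr.
split => //.
have mono : {in `[a, b] &, {mono th : y z / y <= z}}.
  exact: (le_mono_in incr).
have inj : {in `[a, b]%classic &, injective th}.
  move=> y z; rewrite !inE => ya za; exact: (inc_inj_in mono).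
have psiK t : t \in `[a, b] -> psi (th t) = t.
  by move=> tab; apply: pinvKV => //; rewrite inE.
have cpsi : {within `[th a, th b], continuous psi}.
  by apply: segment_can_le_continuous (ltW ab) cwth psiK.
pose g t := L (th t, x t, (dth t)^-1 *: dx t).
have cg t : t \in `[a, b] -> {for t, continuous g}.
  move=> tab; have [_ cdth dth0] := hth t tab; have [_ cdx] := hx t tab.
  apply: (@continuous_comp _ _ _ (fun t => (th t, x t, (dth t)^-1 *: dx t)) L).
    apply: continuous_pair; first by apply: continuous_pair; [exact: cth|exact: cx].
    by apply: cvgZ => //; apply: cvgV => //; rewrite gt_eqF.
  exact: hL.
have surj s : s \in `[th a, th b] -> exists2 t, t \in `[a, b] & th t = s.
  move=> sI; have [t] := segment_continuous_le_surjective (ltW ab) (ltW thab) cwth sI.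
  by exists t.
have cgpsi : {within `[th a, th b], continuous (g \o psi)}.
  suff h : {in psi @` `[th a, th b], continuous g} by exact: within_continuous_comp.
  move=> s; rewrite inE => -[y yI <-].
  by have [t tab <-] := surj y yI; rewrite psiK//; exact: cg.
rewrite (@eq_Rintegral_oo _ (g \o psi))//; last 2 first.
- by apply: continuous_compact_integrable => //; exact: segment_compact.
- move=> s sI; have [t tab ths] := surj s (subset_itv_oo_cc sI).
  have tI : t \in `]a, b[.
    move: sI; rewrite -ths in_itv/= => /andP[at_ tb].
    by rewrite in_itv/= -(leW_mono_in mono)// at_ -(leW_mono_in mono).
  have [dth_t _ dth0] := hth t tab; have [dx_t _] := hx t tab.
  (* inverse function theorem, at an interior point *)
  have dpsi : is_derive (th t) 1 psi (dth t)^-1.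
    apply: is_derive_inverse => //; last by rewrite gt_eqF.
    + near=> u; apply: psiK; apply: subset_itv_oo_cc.
      by near: u; exact: near_in_itvoo.
    + near=> u; apply: cth; apply: subset_itv_oo_cc.
      by near: u; exact: near_in_itvoo.
  have dxt : differentiable x (psi (th t)).
    by rewrite psiK//; apply/derivable1_diffP; case: dx_t.
  have := is_derive_chain dpsi dxt; rewrite psiK// => -[_ dxpsi].
  rewrite /along /g /= -ths psiK// derive1E dxpsi; congr (L (_, _, _)).
  rewrite psiK// in dxt.
  by rewrite deriveE// diff1E// derive1E; case: dx_t => _ ->.
rewrite /Rintegral integration_by_substitution_increasing//; last 5 first.
- exact: ltW.
- move=> t tI; have [_ cdth _] := hth t (subset_itv_oo_cc tI).
  rewrite /continuous_at th'; last exact: subset_itv_oo_cc.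
  move: cdth; apply: cvg_trans; apply: near_eq_cvg; near=> u; rewrite th'//.
  by apply: subset_itv_oo_cc; near: u; exact: near_in_itvoo.
- apply/cvg_ex; exists (dth a).
  have [_ cdth _] := hth a aI.
  apply: cvg_trans (cvg_at_right_filter cdth); apply: near_eq_cvg.
  near=> u; rewrite th'// in_itv/=; apply/andP; split => //.
  by near: u; exact: nbhs_right_le.
- apply/cvg_ex; exists (dth b).
  have [_ cdth _] := hth b bI.
  apply: cvg_trans (cvg_at_left_filter cdth); apply: near_eq_cvg.
  near=> u; rewrite th'// in_itv/=; apply/andP; split => //.
  by near: u; exact: nbhs_left_ge.
- split.
  + by move=> t /subset_itv_oo_cc/hth[[]].
  + by apply: cvg_at_right_filter; exact: cth.
  + by apply: cvg_at_left_filter; exact: cth.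
congr fine; apply: eq_integral => t; rewrite inE => tab /=.
by rewrite fctE/= psiK// th'.
Unshelve. all: end_near. Qed.

End substitution.

(** * Oriented integrals *)

Section oriented.
Variable R : realType.
Local Notation mu := (@lebesgue_measure R).
Variables (I : set R) (interval_I : is_interval I).

Lemma oriented_integralE (f : R -> R) (a b : R) : a <= b ->
  oriented_integral a b f = \int[mu]_(t in `[a, b]) f t.
Proof. by rewrite /oriented_integral => ->. Qed.

Lemma oriented_integralN (f : R -> R) (a b : R) :
  oriented_integral b a f = - oriented_integral a b f.
Proof.
rewrite /oriented_integral; have [ab|ba|->] := ltgtP a b.
- by [].
- by rewrite opprK.
- by rewrite set_itv1 Rintegral_set1 oppr0.
Qed.

Lemma segment_in (a b t : R) : I a -> I b -> t \in `[a, b] -> I t.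
Proof. by move=> Ia Ib; rewrite in_itv/=; exact: interval_I Ia Ib _. Qed.

Lemma is_derive_oriented (F dF : R * R -> R) (a b : R) :
  (forall t, I t -> \forall p \near (0, t), eps_C1 F dF p) -> I a -> I b ->
  is_derive (0 : R) (1 : R) (fun e => oriented_integral a b (fun t => F (e, t)))
    (oriented_integral a b (fun t => dF (0, t))).
Proof.
move=> FdF; wlog ab : a b / a <= b => [hw Ia Ib|Ia Ib].
  have [ab|/ltW ba] := leP a b; first exact: hw.
  rewrite oriented_integralN; under eq_fun do rewrite oriented_integralN.
  by apply: is_deriveN; exact: hw.
rewrite oriented_integralE//; under eq_fun do rewrite oriented_integralE//.
by apply: is_derive_integral => t tab; apply: FdF; exact: segment_in tab.
Qed.

Lemma FTC2_oriented (f df : R -> R) (a b : R) :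
  (forall t, I t -> is_derive t 1 f (df t)) ->
  (forall t, I t -> {for t, continuous df}) -> I a -> I b ->
  oriented_integral a b df = f b - f a.
Proof.
move=> hf cdf; wlog ab : a b / a <= b => [hw Ia Ib|Ia Ib].
  have [ab|/ltW ba] := leP a b; first exact: hw.
  by rewrite oriented_integralN hw// opprB.
rewrite oriented_integralE//; apply: FTC2_segment => // t tab.
  by apply: hf; exact: segment_in tab.
by apply: cdf; exact: segment_in tab.
Qed.

Lemma oriented_integralD (f g : R -> R) (a b : R) :
  (forall t, I t -> {for t, continuous f}) ->
  (forall t, I t -> {for t, continuous g}) -> I a -> I b ->
  oriented_integral a b (fun t => f t + g t) =
  oriented_integral a b f + oriented_integral a b g.
Proof.
move=> cf cg; wlog ab : a b / a <= b => [hw Ia Ib|Ia Ib].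
  have [ab|/ltW ba] := leP a b; first exact: hw.
  by rewrite !(oriented_integralN _ b a) hw// opprD.
rewrite !oriented_integralE// RintegralD//.
- by apply: continuous_segment_integrable => t tab; apply: cf; exact: segment_in tab.
- by apply: continuous_segment_integrable => t tab; apply: cg; exact: segment_in tab.
Qed.

Lemma eq_oriented_integral (f g : R -> R) (a b : R) :
  (forall t, I t -> f t = g t) -> I a -> I b ->
  oriented_integral a b f = oriented_integral a b g.
Proof.
move=> fg; wlog ab : a b / a <= b => [hw Ia Ib|Ia Ib].
  have [ab|/ltW ba] := leP a b; first exact: hw.
  by rewrite !(oriented_integralN _ b a) hw.
rewrite !oriented_integralE//; apply: eq_Rintegral => t; rewrite inE => tab.
by apply: fg; exact: segment_in tab.
Qed.

Hypothesis open_I : open I.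

Lemma nbhs_I t : I t -> \forall u \near t, I u.
Proof. by move=> It; exact: open_nbhs_nbhs. Qed.

Lemma nbhs_I_snd (e t : R) : I t -> \forall p \near (e, t), I p.2.
Proof. by move=> It; exact: (cvg_snd (nbhs_I It)). Qed.

(** Schwarz's theorem at eps = 0.  For eps near 0, Q eps x - Q eps c is the
integral of Qt (eps, _) from c to x.  Differentiating this equality at eps = 0
shows that dQ (0, _) is a primitive of dQt (0, _). *)
Lemma jet_mixed (Q : R -> R -> R) (Qt dQ dQt : R * R -> R) :
  (forall t, I t -> \forall p \near (0, t), jet Q Qt dQ dQt p) ->
  forall t, I t -> is_derive t 1 (fun t => dQ (0, t)) (dQt (0, t)).
Proof.
move=> hQ t It.
have [d /= d0 dI] := nbhs_I It.
pose c := t - d / 2; pose u := t + d / 2.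
have ct : c < t by rewrite /c; lra.
have tu : t < u by rewrite /u; lra.
have cuI s : s \in `[c, u] -> I s.
  rewrite in_itv/= => /andP[cs su]; apply: dI; rewrite /= ltr_norml.
  by move: cs su; rewrite /c /u => cs su; apply/andP; split; lra.
have int_dQt x : x \in `[c, u] ->
    \int[mu]_(s in `[c, x]) dQt (0, s) = dQ (0, x) - dQ (0, c).
  move=> xcu; have cx : c <= x by move: xcu; rewrite in_itv/= => /andP[].
  have cxI s : s \in `[c, x] -> I s.
    move=> scx; apply: cuI; move: scx xcu; rewrite !in_itv/=.
    by move=> /andP[-> sx] /andP[_ xu]; rewrite (le_trans sx).
  have h1 : is_derive (0 : R) 1 (fun e => \int[mu]_(s in `[c, x]) Qt (e, s))
      (\int[mu]_(s in `[c, x]) dQt (0, s)).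
    apply: is_derive_integral => s /cxI/hQ; apply: filterS => p.
    by case.
  have slice y : I y -> is_derive (0 : R) 1 (fun e => Q e y) (dQ (0, y)).
    by move=> /hQ/nbhs_singleton[[_ ? _] _ _].
  have h2 : is_derive (0 : R) 1 (fun e => Q e x - Q e c) (dQ (0, x) - dQ (0, c)).
    by apply: is_deriveB; apply: slice; apply: cxI; rewrite bound_itvE.
  have eqn : \forall e \near (0 : R),
      \int[mu]_(s in `[c, x]) Qt (e, s) = Q e x - Q e c.
    have := @near_segment _ _ c x 0 (fun s sI => hQ s (cxI s sI)).
    apply: filterS => e hs; apply: FTC2_segment => // s sI.
      by have [] := hs s sI.
    by have [_ [? _ _] _] := hs s sI; exact: continuous_slice2.
  have [_ <-] := near_eq_is_derive eqn h1.
  by have [_ <-] := h2.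
have cdQt s : I s -> {for s, continuous (fun t => dQt (0, t))}.
  by move=> /hQ/nbhs_singleton[_ [_ _ ?] _]; exact: continuous_slice2.
have [dF F'] := @continuous_FTC1_closed _ (fun s => dQt (0, s)) c t u tu
  (continuous_segment_integrable (fun s sI => cdQt s (cuI s sI))) ct (cdQt t It).
have h : is_derive t 1 (fun x => \int[mu]_(s in `[c, x]) dQt (0, s) + dQ (0, c))
    (dQt (0, t)).
  apply: is_derive_eq; first apply: is_deriveD.
    by apply: DeriveDef; [exact: dF|rewrite -derive1E F'].
  by rewrite addr0.
apply: near_eq_is_derive h; near=> x.
rewrite int_dQt ?subrK//; apply: subset_itv_oo_cc.
by near: x; apply: near_in_itvoo; rewrite in_itv/= ct tu.
Unshelve. all: end_near. Qed.

End oriented.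

(** * First variation of the action *)

Definition jet_variation (R : realType) (W : normedModType R) (I : set R)
    (f : R -> W) (Q : R -> R -> W) (Qt dQ dQt : R * R -> W) :=
  forall t, I t -> Q 0 t = f t /\ \forall p \near (0, t), jet Q Qt dQ dQt p.

Section first_variation.
Variables (R : realType) (n : nat).
Variables (D : set (R * 'rV[R]_n * 'rV[R]_n)%type).
Variable L : R * 'rV[R]_n * 'rV[R]_n -> R.
Hypothesis open_D : open D.
Hypothesis C1_L : forall x, D x -> C1_at L x.
Variable I : set R.
Hypotheses (open_I : open I) (interval_I : is_interval I).
Variable q : R -> 'rV[R]_n.
Hypothesis q_dom : forall t, I t -> D (t, q t, derive1 q t).

(** The integrand N(eta, tau) of the first variation, where eta, eta', tau and
tau' are dQ, dQt, dTh and dTht at eps = 0. *)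
Definition action_variation (dQ dQt : R * R -> 'rV[R]_n) (dTh dTht : R * R -> R)
    (t : R) : R :=
  'D_(dTh (0, t), dQ (0, t), dQt (0, t) - dTht (0, t) *: derive1 q t) L
    (t, q t, derive1 q t) + along L q t * dTht (0, t).

(** At eps = 0 the time derivative of the family is the velocity of the
unperturbed trajectory, since both agree on the open set I. *)
Lemma jet_velocity (W : normedModType R) (Q : R -> R -> W) (Qt dQ dQt : R * R -> W)
    (f : R -> W) :
  jet_variation I f Q Qt dQ dQt ->
  forall t, I t -> is_derive t 1 f (Qt (0, t)).
Proof.
move=> hQ t It; have [_ /nbhs_singleton[_ _ dQ0]] := hQ t It.
apply: near_eq_is_derive dQ0; near=> u.
by apply: (proj1 (hQ u _)); near: u; exact: nbhs_I.
Unshelve. all: end_near. Qed.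

Section fixed_variation.
Variables (Q : R -> R -> 'rV[R]_n) (Qt dQ dQt : R * R -> 'rV[R]_n).
Variables (Th : R -> R -> R) (Tht dTh dTht : R * R -> R).
Hypothesis hQ : jet_variation I q Q Qt dQ dQt.
Hypothesis hTh : jet_variation I id Th Tht dTh dTht.

(* The point at which L is evaluated, once the action is pulled back to the
   time t by the substitution s = Th eps t. *)
Let state (p : R * R) := (Th p.1 p.2, Q p.1 p.2, (Tht p)^-1 *: Qt p).
Let dstate (p : R * R) := (dTh p, dQ p,
  (Tht p)^-1 *: dQt p + (- (Tht p) ^- 2 * dTht p) *: Qt p).
Let integrand (p : R * R) := L (state p) * Tht p.
Let dintegrand (p : R * R) :=
  L (state p) * dTht p + 'D_(dstate p) L (state p) * Tht p.

Lemma velocity0 t : I t -> Qt (0, t) = derive1 q t.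
Proof. by move=> /(jet_velocity hQ)[_ <-]; rewrite derive1E. Qed.

Lemma time_velocity0 t : I t -> Tht (0, t) = 1.
Proof.
by move=> /(@jet_velocity _ _ _ _ _ id hTh)[_ <-]; rewrite derive_id.
Qed.

Lemma state0 t : I t -> state (0, t) = (t, q t, derive1 q t).
Proof.
move=> It; rewrite /state /= velocity0// time_velocity0// invr1 scale1r.
by have [-> _] := hQ It; have [-> _] := hTh It.
Qed.

(** At eps = 0 the time change is the identity, of speed 1, and the state lies in
the open set D: both persist for small eps. *)
Lemma near_admissible t : I t -> \forall p \near (0, t),
  [/\ jet Q Qt dQ dQt p, jet Th Tht dTh dTht p, 0 < Tht p & D (state p)].
Proof.
move=> It; have [_ jQ] := hQ It; have [_ jTh] := hTh It.
have [[cQ _ _] [cQt _ _] _] := nbhs_singleton jQ.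
have [[cTh _ _] [cTht _ _] _] := nbhs_singleton jTh.
have Tht0 : 0 < Tht (0, t) by rewrite time_velocity0.
have cstate : {for (0, t), continuous state}.
  apply: continuous_pair; first exact: continuous_pair.
  by apply: cvgZ => //; apply: cvgV => //; rewrite gt_eqF.
have Dst : D (state (0, t)) by rewrite state0//; exact: q_dom.
near=> p; split; first by near: p.
- by near: p.
- by near: p; exact: (cvgr_gt (Tht (0, t))).
- by near: p; apply: cstate; exact: open_nbhs_nbhs.
Unshelve. all: end_near. Qed.

Lemma eps_C1_integrand t : I t -> \forall p \near (0, t), eps_C1 integrand dintegrand p.
Proof.
move=> /near_admissible; apply: filterS => p [[hQ1 hQ2 _] [hT1 hT2 _] Tht0 Dst].
have hV := eps_C1V (lt0r_neq0 Tht0) hT2.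
have hstate : eps_C1 state dstate p := eps_C1_pair (eps_C1_pair hT1 hQ1) (eps_C1Z hV hQ2).
exact: (eps_C1M (eps_C1_comp_lagrangian hstate (C1_L Dst)) hT2).
Qed.

Lemma dintegrand0 t : I t -> dintegrand (0, t) = action_variation dQ dQt dTh dTht t.
Proof.
move=> It; rewrite /dintegrand /dstate state0// time_velocity0// velocity0//.
rewrite /action_variation /along addrC mulr1 invr1 expr1n invr1 scale1r.
by rewrite mulN1r scaleNr.
Qed.

Lemma continuous_action_variation t : I t ->
  {for t, continuous (action_variation dQ dQt dTh dTht)}.
Proof.
move=> It; have [_ _ /continuous_slice2 c] := nbhs_singleton (eps_C1_integrand It).
rewrite /prop_for /continuous_at -dintegrand0//.
move: c; apply: cvg_trans; apply: near_eq_cvg; near=> u.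
by rewrite dintegrand0//; near: u; exact: nbhs_I.
Unshelve. all: end_near. Qed.

(** The time change increases on the whole segment once eps is small, by
[near_segment]; on this segment it can be inverted and the action rewritten with
bounds independent of eps. *)
Lemma action_reparam_lt a b : a < b -> I a -> I b -> \forall e \near (0 : R),
  Th e a < Th e b /\
  action L (Th e a) (Th e b) (reparam a b Q Th e) =
  oriented_integral a b (fun t => integrand (e, t)).
Proof.
move=> ab Ia Ib.
have := @near_segment _ _ a b 0
  (fun t tab => near_admissible (segment_in interval_I Ia Ib tab)).
apply: filterS => e he.
have [Thab intE] : Th e a < Th e b /\
    \int[lebesgue_measure]_(s in `[Th e a, Th e b])
      along L (Q e \o 'pinv_(fun=> point) `[a, b] (Th e)) s =
    \int[lebesgue_measure]_(t in `[a, b]) integrand (e, t).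
  apply: (@Rintegral_along_reparam _ _ L (Th e) (fun t => Tht (e, t)) (Q e)
    (fun t => Qt (e, t))) => // t tab; have [[_ [? _ _] ?] [_ [? _ _] ?] ? ?] := he t tab.
  - by split => //; exact: continuous_slice2.
  - by split => //; exact: continuous_slice2.
  - have [/nbhs_singleton dL _] := @C1_L (state (e, t)) ltac:(assumption).
    exact: (differentiable_continuous dL).
split; first exact: Thab.
rewrite /action (oriented_integralE _ (ltW Thab)) (oriented_integralE _ (ltW ab)).
by rewrite -intE /reparam (min_idPl (ltW ab)) (max_idPr (ltW ab)).
Qed.

Lemma reparamC a b e : reparam a b Q Th e = reparam b a Q Th e.
Proof. by rewrite /reparam minC maxC. Qed.

Lemma action_reparam a b : I a -> I b -> \forall e \near (0 : R),
  action L (Th e a) (Th e b) (reparam a b Q Th e) =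
  oriented_integral a b (fun t => integrand (e, t)).
Proof.
move=> Ia Ib; have [ab|ba|<-] := ltgtP a b.
- by apply: filterS (action_reparam_lt ab Ia Ib) => e [].
- apply: filterS (action_reparam_lt ba Ib Ia) => e [_ h].
  by rewrite reparamC [RHS]oriented_integralN -h /action oriented_integralN.
- near=> e; rewrite /action !oriented_integralE//.
  by rewrite !set_itv1 !Rintegral_set1.
Unshelve. all: end_near. Qed.

Lemma is_derive_oriented_integrand a b : I a -> I b ->
  is_derive (0 : R) (1 : R) (fun e => oriented_integral a b (fun t => integrand (e, t)))
    (oriented_integral a b (action_variation dQ dQt dTh dTht)).
Proof.
move=> Ia Ib.
rewrite -(eq_oriented_integral interval_I (f := fun t => dintegrand (0, t)) dintegrand0 Ia Ib).
by apply: is_derive_oriented Ia Ib => //; exact: eps_C1_integrand.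
Qed.

Lemma is_derive_action_reparam a b : I a -> I b ->
  is_derive (0 : R) (1 : R)
    (fun e => action L (Th e a) (Th e b) (reparam a b Q Th e))
    (oriented_integral a b (action_variation dQ dQt dTh dTht)).
Proof.
move=> Ia Ib; apply: near_eq_is_derive (is_derive_oriented_integrand Ia Ib).
by apply: filterS (action_reparam Ia Ib) => e ->.
Qed.

End fixed_variation.

Lemma jet_variation_id :
  jet_variation I (@id R) (fun=> id) (fun=> 1) (fun=> 0) (fun=> 0).
Proof.
move=> t _; split=> //; near=> p; split; last exact: is_derive_id.
- by apply: (@eps_C1_slice _ R id); exact: cvg_id.
- by apply: (@eps_C1_slice _ R (fun=> 1)); exact: cvg_cst.
Unshelve. all: end_near. Qed.

Lemma is_derive_action Q Qt dQ dQt a b : jet_variation I q Q Qt dQ dQt -> I a -> I b ->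
  is_derive (0 : R) (1 : R) (fun e => action L a b (Q e))
    (oriented_integral a b (action_variation dQ dQt (fun=> 0) (fun=> 0))).
Proof.
move=> hQ Ia Ib.
apply: near_eq_is_derive (is_derive_oriented_integrand hQ jet_variation_id Ia Ib).
wlog ab : a b Ia Ib / a <= b => [hw|].
  have [ab|/ltW ba] := leP a b; first exact: hw.
  apply: filterS (hw b a Ib Ia ba) => e.
  by rewrite /action !(oriented_integralN _ b a) => ->.
have := @near_segment _ _ a b 0
  (fun t tab => (hQ t (segment_in interval_I Ia Ib tab)).2).
apply: filterS => e he; rewrite /action !oriented_integralE//.
apply: eq_Rintegral => t; rewrite inE => /he[_ _ [_ /= dQe]].
by rewrite /along derive1E dQe invr1 scale1r mulr1.
Qed.

End first_variation.

(** * Families coming from smooth functions *)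

Lemma near_continuous (T U : topologicalType) (f : T -> U) (P : U -> Prop) (x : T) :
  {for x, continuous f} -> (\forall y \near f x, P y) ->
  \forall y \near x, P (f y).
Proof. by move=> cf nP; exact: (cf _ nP). Qed.

Section families.
Variables (R : realType) (I : set R).
Hypothesis open_I : open I.

Lemma smooth_family_C1 (W : normedModType R) (f : R -> R -> W)
    (F := fun z : R * R => f z.1 z.2) :
  smooth_family I f -> forall t, I t -> \forall p \near (0, t),
    C1_at F p /\ C1_at (fun z => 'D_(0, 1) F z) p.
Proof.
move=> [U [oU IU sU]] t It.
have : \forall p \near ((0 : R), t), U p by apply: open_nbhs_nbhs; split=> //; exact: IU.
apply: filterS => p Up; split; first exact: (C1_at_Ck oU Up (sU 1%N)).
exact: (C1_at_derive _ oU Up (sU 2%N)).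
Qed.

Lemma smooth_family_jet (W : normedModType R) (f : R -> R -> W)
    (F := fun z : R * R => f z.1 z.2) :
  smooth_family I f -> forall t, I t -> \forall p \near (0, t),
    jet f (fun z => 'D_(0, 1) F z) (fun z => 'D_(1, 0) F z)
      (fun z => 'D_(1, 0) (fun y => 'D_(0, 1) F y) z) p.
Proof.
move=> /smooth_family_C1 sf t /sf; apply: filterS => p [? ?].
exact: jet_C2.
Qed.

Lemma jet_d_eps0 (W : normedModType R) (Q : R -> R -> W) (Qt dQ dQt : R * R -> W) t :
  (\forall p \near (0, t), jet Q Qt dQ dQt p) -> d_eps0 Q t = dQ (0, t).
Proof. by move=> /nbhs_singleton[[_ [_ <-] _] _ _]; rewrite /d_eps0 derive1E. Qed.

Variables (n : nat) (q v w : R -> 'rV[R]_n) (qe : R -> R -> 'rV[R]_n).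
Hypothesis space_qe : space_change I q qe.
Hypothesis q_derive : forall t, I t -> is_derive t 1 q (v t).
Hypothesis v_derive : forall t, I t -> is_derive t 1 v (w t).
Hypothesis w_cont : forall t, I t -> {for t, continuous w}.
Let F (z : R * R) := qe z.1 z.2.
Let Ft (z : R * R) := 'D_(0, 1) F z.
Variables s ds : R -> R.
Hypothesis s_derive : forall t, I t -> is_derive t 1 s (ds t).
Hypothesis ds_cont : forall t, I t -> {for t, continuous ds}.

Lemma smooth_family_variation : jet_variation I q qe Ft (fun z => 'D_(1, 0) F z)
  (fun z => 'D_(1, 0) Ft z).
Proof.
move=> t It; split; first by have [_ ->] := space_qe.
by have [sq _] := space_qe; exact: (smooth_family_jet sq).
Qed.

Lemma Ft0 t : I t -> Ft (0, t) = v t.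
Proof.
move=> It; have [_ <-] := jet_velocity open_I smooth_family_variation It.
by have [_ ->] := q_derive It.
Qed.

(** To first order in eps, q_eps(t + eps s(t)) and q_eps(t) + eps s(t) v(t) both
move q_eps along the trajectory by the time eps s(t).  Differentiating in t the
resulting eta + s v adds s' v + s w to eta', for the acceleration w is the time
derivative of [Ft] at eps = 0. *)
Lemma shift_variation (Q : R -> R -> 'rV[R]_n) :
  Q = (fun e t => qe e (t + e * s t)) \/
  Q = (fun e t => qe e t + (e * s t) *: v t) ->
  exists Qt dQ dQt, jet_variation I q Q Qt dQ dQt /\
    forall t, I t -> dQ (0, t) = 'D_(1, 0) F (0, t) + s t *: v t /\
      dQt (0, t) = 'D_(1, 0) Ft (0, t) + (ds t *: v t + s t *: w t).
Proof.
move=> Qdef; case: (space_qe) => sqe qe0; case: Qdef => ->.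
- pose phi z : R * R := (z.1, z.2 + z.1 * s z.2).
  exists (fun z => (1 + z.1 * ds z.2) *: Ft (phi z)).
  exists (fun z => 'D_(1, s z.2) F (phi z)).
  exists (fun z => (1 + z.1 * ds z.2) *: 'D_(1, s z.2) Ft (phi z)
              + ds z.2 *: Ft (phi z)).
  have phi0 t : phi (0, t) = (0, t) by rewrite /phi mul0r addr0.
  split=> [t It|t It]; last first.
    have [CF CFt] := nbhs_singleton (smooth_family_C1 sqe It).
    rewrite mul0r addr0 scale1r phi0 Ft0//.
    rewrite (derive_planar _ (nbhs_singleton CF.1)).
    rewrite (derive_planar _ (nbhs_singleton CFt.1)) !scale1r /=.
    have -> : 'D_(0, 1) F (0, t) = v t by exact: Ft0.
    suff -> : 'D_(0, 1) Ft (0, t) = w t by rewrite -addrA [ds t *: _ + _]addrC.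
    have [_ <-] := is_derive_slice2 (nbhs_singleton CFt.1).
    have [_ <-] := v_derive It; apply: near_eq_derive; near=> u.
    by apply: Ft0; near: u; exact: nbhs_I.
  split; first by rewrite mul0r addr0 qe0.
  have cphi : {for (0, t), continuous phi}.
    apply: continuous_pair; first exact: cvg_fst.
    have cs : {for t, continuous s} := derivable_continuous (s_derive It).
    apply: cvgD; first exact: cvg_snd.
    by apply: cvgM; [exact: cvg_fst|
      exact: (@continuous_comp _ _ _ (@snd R R) s (0, t) cvg_snd cs)].
  have nC : \forall p \near (0, t), C1_at F (phi p) /\ C1_at Ft (phi p).
    have nF : \forall p \near phi (0, t), C1_at F p /\ C1_at Ft p.
      by rewrite phi0; exact: smooth_family_C1.
    exact: (near_continuous cphi nF).
  have nI := nbhs_I_snd open_I 0 It.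
  near=> p; have Ip : I p.2 by near: p.
  have [CF CFt] : C1_at F (phi p) /\ C1_at Ft (phi p) by near: p.
  exact: (jet_shift (Q := qe) (s_derive Ip) (ds_cont Ip) CF CFt).
- pose h t := s t *: v t; pose dh t := ds t *: v t + s t *: w t.
  have hh t : I t -> is_derive t 1 h (dh t).
    move=> It; rewrite /dh addrC.
    by apply: is_derive_scale; [exact: s_derive|exact: v_derive].
  have cdh t : I t -> {for t, continuous dh}.
    move=> It; have cs := derivable_continuous (s_derive It).
    have cv := derivable_continuous (v_derive It).
    by apply: cvgD; apply: cvgZ => //; [exact: ds_cont|exact: w_cont].
  exists (Ft \+ (fun z => z.1 *: dh z.2)).
  exists ((fun z => 'D_(1, 0) F z) \+ (fun z => h z.2)).
  exists ((fun z => 'D_(1, 0) Ft z) \+ (fun z => dh z.2)).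
  split=> // t It; have [_ nj] := smooth_family_variation It.
  split; first by rewrite mul0r scale0r addr0 qe0.
  have -> : (fun e t => qe e t + (e * s t) *: v t) =
      (fun e t => qe e t + e *: h t).
    by apply/funext => e; apply/funext => u; rewrite scalerA.
  have nI := nbhs_I_snd open_I 0 It.
  near=> p; have Ip : I p.2 by near: p.
  apply: (jetD (P := fun e t => e *: h t)); first by near: p.
  by apply: jet_linear; [exact: hh|exact: cdh].
Unshelve. all: end_near. Qed.

End families.

(** * Shifts along the trajectory *)

Section shift_identity.
Variables (R : realType) (n : nat) (L : R * 'rV[R]_n * 'rV[R]_n -> R).
Variables (q w : R -> 'rV[R]_n).

(** The terms s' v coming from eta' and from tau' v cancel, so the direction in
which L is differentiated changes by s (1, v, w). *)
Lemma action_variation_shift (s ds : R) (t : R)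
    (dQ dQt dQ' dQt' : R * R -> 'rV[R]_n) (dTh dTht dTh' dTht' : R * R -> R) :
  differentiable L (t, q t, derive1 q t) ->
  dQ' (0, t) = dQ (0, t) + s *: derive1 q t ->
  dQt' (0, t) = dQt (0, t) + (ds *: derive1 q t + s *: w t) ->
  dTh' (0, t) = dTh (0, t) + s -> dTht' (0, t) = dTht (0, t) + ds ->
  action_variation L q dQ' dQt' dTh' dTht' t =
  action_variation L q dQ dQt dTh dTht t +
    (s * 'D_(1, derive1 q t, w t) L (t, q t, derive1 q t) + ds * along L q t).
Proof.
move=> dL hQ hQt hTh hTht; rewrite /action_variation hQ hQt hTh hTht.
set v0 := (X in _ = 'D_X L _ + _ + _).
set u := (1, derive1 q t, w t).
rewrite [X in 'D_X L _ + _ = _](_ : _ = v0 + s *: u); last first.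
  congr (_, _, _) => /=; first by congr (_ + _); exact: (esym (mulr1 s)).
  apply/rowP => j; rewrite !mxE; ring.
rewrite !deriveE// linearD linearZ /= -[s *: _]/(s * _); ring.
Qed.

End shift_identity.

Lemma is_derive0P (R : realType) (f : R -> R) (x l : R) :
  is_derive x 1 f l -> is_derive x 1 f 0 <-> l = 0.
Proof. by move=> fl; split=> [[_ <-]|<-//]; case: fl. Qed.

(** The infinitesimal generator of a family is only defined pointwise in t;
[jet_mixed] makes it a C^1 function of t, as tau and g have to be. *)
Lemma d_eps0_derive (R : realType) (I : set R) (f : R -> R -> R)
    (ft df dft : R * R -> R) : open I ->
  (forall t, I t -> \forall p \near (0, t), jet f ft df dft p) ->
  forall t, I t -> is_derive t 1 (d_eps0 f) (dft (0, t)) /\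
    {for t, continuous (fun u => dft (0, u))}.
Proof.
move=> oI jf t It; split; last first.
  by have [_ [_ _ ?] _] := nbhs_singleton (jf t It); exact: continuous_slice2.
apply: near_eq_is_derive (jet_mixed oI jf It); near=> u.
by apply/esym/jet_d_eps0/jf; near: u; exact: nbhs_I.
Unshelve. all: end_near. Qed.

Lemma is_derive_with_boundary (R : realType) (S f g : R -> R) (x V df dg : R) :
  is_derive x 1 S V -> is_derive x 1 f df -> is_derive x 1 g dg ->
  is_derive x 1 (fun e => S e + f e - g e) (V + df - dg).
Proof. by move=> hS hf hg; apply: is_deriveB. Qed.

Section shift_integral.
Variables (R : realType) (n : nat).
Variables (D : set (R * 'rV[R]_n * 'rV[R]_n)%type).
Variable L : R * 'rV[R]_n * 'rV[R]_n -> R.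
Hypothesis open_D : open D.
Hypothesis C1_L : forall x, D x -> C1_at L x.
Variable I : set R.
Hypotheses (open_I : open I) (interval_I : is_interval I).
Variables q w : R -> 'rV[R]_n.
Hypothesis q_derive : forall t, I t -> is_derive t 1 q (derive1 q t).
Hypothesis v_derive : forall t, I t -> is_derive t 1 (derive1 q) (w t).
Hypothesis w_cont : forall t, I t -> {for t, continuous w}.
Hypothesis q_dom : forall t, I t -> D (t, q t, derive1 q t).

Let along' (t : R) : R := 'D_(1, derive1 q t, w t) L (t, q t, derive1 q t).

(** (1, v, w) is the velocity of the curve (t, q(t), v(t)). *)
Lemma is_derive_along t : I t -> is_derive t 1 (along L q) (along' t).
Proof.
move=> It; have [/nbhs_singleton dL _] := C1_L (q_dom It).
have h : is_derive t 1 (fun t => (t, q t, derive1 q t)) (1, derive1 q t, w t).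
  apply: is_derive_pair; last exact: v_derive.
  by apply: is_derive_pair; exact: q_derive.
exact: (is_derive_chain h dL).
Qed.

Lemma continuous_along' t : I t -> {for t, continuous along'}.
Proof.
move=> It; have [nL cL] := C1_L (q_dom It).
have cq := derivable_continuous (q_derive It).
have cv := derivable_continuous (v_derive It).
apply: continuous_derive => //.
  by apply: continuous_pair => //; apply: continuous_pair => //; exact: cvg_id.
apply: continuous_pair; last exact: w_cont.
by apply: continuous_pair => //; exact: cvg_cst.
Qed.

(** By [action_variation_shift] and [is_derive_along], the variation increases
by the derivative of r Lambda, which the fundamental theorem integrates. *)
Lemma oriented_action_variation_shift (r dr : R -> R)
    (Q : R -> R -> 'rV[R]_n) (Qt dQ dQt dQ' dQt' : R * R -> 'rV[R]_n)
    (Th : R -> R -> R) (Tht dTh dTht dTh' dTht' : R * R -> R) (a b : R) :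
  jet_variation I q Q Qt dQ dQt -> jet_variation I id Th Tht dTh dTht ->
  (forall t, I t -> is_derive t 1 r (dr t)) ->
  (forall t, I t -> {for t, continuous dr}) ->
  (forall t, I t -> dQ' (0, t) = dQ (0, t) + r t *: derive1 q t /\
     dQt' (0, t) = dQt (0, t) + (dr t *: derive1 q t + r t *: w t)) ->
  (forall t, I t -> dTh' (0, t) = dTh (0, t) + r t /\
     dTht' (0, t) = dTht (0, t) + dr t) ->
  I a -> I b ->
  oriented_integral a b (action_variation L q dQ' dQt' dTh' dTht') =
  oriented_integral a b (action_variation L q dQ dQt dTh dTht)
  + (r b * along L q b - r a * along L q a).
Proof.
move=> hQ hTh r_der dr_cont EQ ETh Ia Ib.
pose rL t := r t * along' t + dr t * along L q t.
have rL_cont t : I t -> {for t, continuous rL}.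
  move=> It; have rc := derivable_continuous (r_der t It).
  have Lc := derivable_continuous (is_derive_along It).
  by apply: cvgD; [exact: (cvgM rc (continuous_along' It))
                  |exact: (cvgM (dr_cont t It) Lc)].
have rL_der t : I t -> is_derive t 1 (fun t => r t * along L q t) (rL t).
  by move=> It; exact: (is_derive_scale (r_der t It) (is_derive_along It)).
rewrite -(FTC2_oriented interval_I rL_der rL_cont Ia Ib).
rewrite -(oriented_integralD interval_I _ rL_cont Ia Ib); last first.
  by move=> t It; exact: (continuous_action_variation open_D C1_L open_I q_dom hQ hTh).
apply: (eq_oriented_integral interval_I) => // t It.
have [h1 h2] := EQ t It; have [h3 h4] := ETh t It.
apply: action_variation_shift h1 h2 h3 h4.
by have [/nbhs_singleton] := C1_L (q_dom It).
Qed.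

End shift_integral.

Lemma d_eps0_linear (R : realType) (W : normedModType R) (c : R -> R) (t : R) :
  d_eps0 (fun e t => e * c t) t = c t.
Proof.
rewrite /d_eps0 derive1E.
have h : is_derive (0 : R) 1 (fun e : R => e *: c t) (0 *: 0 + 1 *: c t).
  by apply: is_derive_scale; exact: is_derive_id.
by rewrite (@derive_val _ _ _ _ _ _ _ h) scale0r add0r [LHS]mul1r.
Qed.

Lemma is_derive_div (R : realType) (f h : R -> R) (x df dh : R) : h x != 0 ->
  is_derive x 1 f df -> is_derive x 1 h dh ->
  is_derive x 1 (fun y => f y / h y) (df / h x - f x * dh / h x ^+ 2).
Proof.
move=> h0 hf hh.
have hV : is_derive x 1 (fun y => (h y)^-1) (- h x ^- 2 *: dh).
  exact: is_deriveV.
apply: is_derive_eq (is_derive_scale hf hV) _.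
rewrite -[- _ *: dh]/(_ * _) -![_ *: _]/(_ * _); field; exact: h0.
Qed.

(** * Equivalence of the invariance conditions *)

Theorem theorem10 (R : realType) (n : nat) (n_ge1 : (1 <= n)%N)
    (D : set (R * 'rV[R]_n * 'rV[R]_n)%type)
    (L : R * 'rV[R]_n * 'rV[R]_n -> R)
    (open_D : open D) (smooth_L : smooth_on D L)
    (I : set R) (open_I : open I) (interval_I : is_interval I)
    (q : R -> 'rV[R]_n) (smooth_q : smooth_on I q)
    (q_dom : forall t, I t -> D (t, q t, derive1 q t))
    (qe : R -> R -> 'rV[R]_n) (theta G : R -> R -> R)
    (space_qe : space_change I q qe) (time_theta : time_change I theta)
    (BH_G : BH_function I G)
    (L_neq0 : forall t, I t -> L (t, q t, derive1 q t) != 0) :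
  forall Q1 Q2 : R -> R -> 'rV[R]_n,
    (Q1 = (fun e t => qe e (t + e * d_eps0 (calT L q G) t)) \/
     Q1 = (fun e t => qe e t + (e * d_eps0 (calT L q G) t) *: derive1 q t)) ->
    (Q2 = (fun e t => qe e (t - e * d_eps0 theta t)) \/
     Q2 = (fun e t => qe e t - (e * d_eps0 theta t) *: derive1 q t)) ->
  [<->
    alt_BH_invariant L I Q1 (fun e t => theta e t + calT L q G e t)
      (fun _ _ => 0);
    BH_invariant L I Q2 (fun e t => G e t + calG L q theta e t);
    alt_BH_invariant L I qe theta G].
Proof.
move=> Q1 Q2 hQ1 hQ2.
pose w t := 'D_1 (derive1 q) t.
have vE : derive1 q = fun t => 'D_1 q t by apply/funext => t; rewrite derive1E.
have C1_L x : D x -> C1_at L x.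
  by move=> Dx; exact: (C1_at_Ck open_D Dx (smooth_L 1%N)).
have q_der t : I t -> is_derive t 1 q (derive1 q t).
  move=> It; have [/nbhs_singleton dq _] := C1_at_Ck open_I It (smooth_q 1%N).
  by rewrite vE; exact/derivableP/derivable1_diffP.
have C1_v t : I t -> C1_at (derive1 q) t.
  by move=> It; rewrite vE; exact: (C1_at_derive _ open_I It (smooth_q 2%N)).
have v_der t : I t -> is_derive t 1 (derive1 q) (w t).
  by move=> /C1_v[/nbhs_singleton dv _]; exact/derivableP/derivable1_diffP.
have w_cont t : I t -> {for t, continuous w} by move=> /C1_v[_ cv]; exact: (cv 1).
have Lam_der := is_derive_along C1_L q_der v_der q_dom.
have Lam'_cont := continuous_along' C1_L q_der v_der w_cont q_dom.
set Lam := along L q in Lam_der.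
set Lam' := (X in forall t, I t -> is_derive t 1 Lam (X t)) in Lam_der.
have Lam_cont t (It : I t) := derivable_continuous (Lam_der t It).
(* the infinitesimal generators tau and g, which are C^1 *)
case: (time_theta) => sth th0.
have jth := smooth_family_jet sth; have jG := smooth_family_jet BH_G.
set Tht := (fun z => 'D_(0, 1) (fun z : R * R => theta z.1 z.2) z) in jth.
set dTh := (fun z => 'D_(1, 0) (fun z : R * R => theta z.1 z.2) z) in jth.
set dTht := (fun z => 'D_(1, 0) Tht z) in jth.
set dGt := (fun z => 'D_(1, 0) (fun y =>
  'D_(0, 1) (fun z : R * R => G z.1 z.2) y) z) in jG.
pose tau : R -> R := d_eps0 theta; pose g : R -> R := d_eps0 G.
have tauE t : I t -> dTh (0, t) = tau t.
  by move=> It; rewrite -(jet_d_eps0 (jth t It)).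
pose dtau (t : R) : R := dTht (0, t); pose dg (t : R) : R := dGt (0, t).
have tau_C1 t (It : I t) := d_eps0_derive open_I jth It.
have g_C1 t (It : I t) := d_eps0_derive open_I jG It.
(* the shift of condition (1); its boundary term s Lambda is g *)
pose s : R -> R := d_eps0 (calT L q G).
pose ds (t : R) : R := dg t / Lam t - g t * Lam' t / Lam t ^+ 2.
have sE t : s t = g t / Lam t.
  by rewrite /s (@d_eps0_linear _ R (fun t => g t / Lam t)).
have s_der t : I t -> is_derive t 1 s (ds t).
  move=> It; have -> : s = (fun t => g t / Lam t) by apply/funext => u; rewrite sE.
  exact: (is_derive_div (L_neq0 t It) (g_C1 t It).1 (Lam_der t It)).
have ds_cont t : I t -> {for t, continuous ds}.
  move=> It; have Lc := Lam_cont t It; have L0 := L_neq0 t It.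
  have [/derivable_continuous gc dgc] := g_C1 t It.
  apply: cvgB; first exact: (cvgM dgc (cvgV L0 Lc)).
  apply: (cvgM (cvgM gc (Lam'_cont t It))).
  by apply: cvgV; [rewrite expf_neq0|rewrite expr2; exact: (cvgM Lc Lc)].
have jT t : I t -> \forall p \near (0, t), 
    jet (fun e t => theta e t + calT L q G e t)
     (Tht \+ (fun z => z.1 * ds z.2)) (dTh \+ (fun z => s z.2))
     (dTht \+ (fun z => ds z.2)) p.
  move=> It; near=> p.
  have Ip : I p.2 by near: p; exact: nbhs_I_snd.
  apply: (jetD (P := calT L q G)); first by near: p; exact: jth.
  have -> : calT L q G = (fun e t => e *: s t).
    by apply/funext => e; apply/funext => u; rewrite sE.
  exact: (@jet_linear _ R s ds p (s_der _ Ip) (ds_cont _ Ip)).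
have hTh : jet_variation I id theta Tht dTh dTht.
  by move=> t It; split; [exact: th0|exact: jth].
have hTh1 : jet_variation I id (fun e t => theta e t + calT L q G e t)
     (Tht \+ (fun z => z.1 * ds z.2)) (dTh \+ (fun z => s z.2))
     (dTht \+ (fun z => ds z.2)).
  by move=> t It; split; [rewrite th0// /calT mul0r addr0|exact: jT].
have hq := smooth_family_variation space_qe.
have [Q1t [dQ1 [dQ1t [hv1 E1]]]] := shift_variation open_I space_qe q_der v_der
  w_cont s_der ds_cont hQ1.
(* condition (2) shifts by - tau *)
have {}hQ2 : Q2 = (fun e t => qe e (t + e * - tau t)) \/
    Q2 = (fun e t => qe e t + (e * - tau t) *: derive1 q t).
  case: hQ2 => ->; [left|right]; apply/funext => e; apply/funext => t.
    by rewrite mulrN.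
  by rewrite mulrN scaleNr.
have tauN_der t (It : I t) : is_derive t 1 (fun t => - tau t) (- dtau t).
  exact: (is_deriveN (tau_C1 t It).1).
have dtauN_cont t (It : I t) : {for t, continuous (fun t => - dtau t)}.
  exact: (cvgN (tau_C1 t It).2).
have [Q2t [dQ2 [dQ2t [hv2 E2]]]] := shift_variation open_I space_qe q_der v_der
  w_cont tauN_der dtauN_cont hQ2.
pose dQ := fun z : R * R => 'D_(1, 0) (fun z : R * R => qe z.1 z.2) z.
pose dQt := fun z : R * R => 'D_(1, 0) (fun y : R * R =>
  'D_(0, 1) (fun z : R * R => qe z.1 z.2) y) z.
pose V a b := oriented_integral a b (action_variation L q dQ dQt dTh dTht).
have dG t : I t -> is_derive (0 : R) (1 : R) (fun e => G e t) (g t).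
  move=> It; rewrite /g (jet_d_eps0 (jG t It)).
  by have [[_ ? _] _ _] := nbhs_singleton (jG t It).
(* the three functions have the derivative V a b + g b - g a at 0 *)
have D3 a b : I a -> I b -> is_derive (0 : R) (1 : R)
    (fun e => action L (theta e a) (theta e b) (reparam a b qe theta e)
                + G e b - G e a) (V a b + g b - g a).
  move=> Ia Ib.
  have h := is_derive_action_reparam open_D C1_L open_I interval_I q_dom hq hTh Ia Ib.
  exact: (is_derive_with_boundary h (dG b Ib) (dG a Ia)).
have D2 a b : I a -> I b -> is_derive (0 : R) (1 : R)
    (fun e => action L a b (Q2 e) + (G e b + calG L q theta e b)
      - (G e a + calG L q theta e a)) (V a b + g b - g a).
  move=> Ia Ib.
  have dGG t : I t -> is_derive (0 : R) (1 : R)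
      (fun e => G e t + calG L q theta e t) (g t + Lam t * tau t).
    move=> It.
    have h : is_derive (0 : R) 1 (fun e : R => e *: (Lam t * tau t)) (1 *: (Lam t * tau t)).
      by rewrite -[1 *: _]add0r -[X in X + _](scaler0 _ (0 : R)); 
        exact: (is_derive_scale (is_derive_id _ _) (is_derive_cst _ _ _)).
    by rewrite scale1r in h; exact: (is_deriveD (dG t It) h).
  have h := is_derive_action open_D C1_L open_I interval_I q_dom hv2 Ia Ib.
  apply: is_derive_eq (is_derive_with_boundary h (dGG b Ib) (dGG a Ia)) _.
  rewrite (oriented_action_variation_shift open_D C1_L open_I interval_I q_der v_der
    w_cont q_dom hq hTh tauN_der dtauN_cont E2 _ Ia Ib); first by rewrite /V /Lam; ring.
  by move=> t It; rewrite tauE// !subrr.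
have D1 a b : I a -> I b -> is_derive (0 : R) (1 : R)
    (fun e => action L (theta e a + calT L q G e a) (theta e b + calT L q G e b)
       (reparam a b Q1 (fun e t => theta e t + calT L q G e t) e) + 0 - 0)
    (V a b + g b - g a).
  move=> Ia Ib.
  have h := is_derive_action_reparam open_D C1_L open_I interval_I q_dom hv1 hTh1 Ia Ib.
  under eq_fun do rewrite addr0 subr0.
  apply: is_derive_eq h _.
  rewrite (oriented_action_variation_shift open_D C1_L open_I interval_I q_der v_der
    w_cont q_dom hq hTh s_der ds_cont E1 _ Ia Ib)//.
  by rewrite !sE !divfK ?L_neq0// addrA.
have inv1 : alt_BH_invariant L I Q1 (fun e t => theta e t + calT L q G e t)
    (fun _ _ => 0) <-> forall a b, I a -> I b -> V a b + g b - g a = 0.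
  by split=> h a b Ia Ib; apply/(is_derive0P (D1 a b Ia Ib)); exact: h.
have inv2 : BH_invariant L I Q2 (fun e t => G e t + calG L q theta e t) <->
    forall a b, I a -> I b -> V a b + g b - g a = 0.
  by split=> h a b Ia Ib; apply/(is_derive0P (D2 a b Ia Ib)); exact: h.
have inv3 : alt_BH_invariant L I qe theta G <->
    forall a b, I a -> I b -> V a b + g b - g a = 0.
  by split=> h a b Ia Ib; apply/(is_derive0P (D3 a b Ia Ib)); exact: h.
by tfae; rewrite ?inv1 ?inv2 ?inv3.
Unshelve. all: end_near. Qed.
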